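(* Let $\mu$ be a probability measure on $\mathbb{R}$ with finite variance, and write $H_\mu(z)=a+z+\int_{\mathbb{R}}\frac{1}{x-z}\,d\rho(x)$ with $a\in\mathbb{R}$ and $\rho$ a positive finite measure (so $\rho(\mathbb{R})$ is the variance of $\mu$). (1) Assume $\mu$ is $\rhd$-$n$-divisible for an integer $n\ge1$. If $z_1\neq z_2$ are points of $\mathbb{C}^+$ with $\operatorname{Im}z_1\cdot\operatorname{Im}z_2>\frac{\rho(\mathbb{R})}{n}$, then $H_\mu(z_1)\neq H_\mu(z_2)$. In particular $H_\mu$ is injective on $\{z\in\mathbb{C}^+:\operatorname{Im}z>\sqrt{\rho(\mathbb{R})/n}\}$. Moreover the constant $\frac{\rho(\mathbb{R})}{n}$ is optimal: for every $n$ there exist such a $\mu$ (finite variance, $\rhd$-$n$-divisible) and points $z_1\ne z_2$ in $\mathbb{C}^+$ with $\operatorname{Im}z_1\cdot\operatorname{Im}z_2=\frac{\rho(\mathbb{R})}{n}$ and $H_\mu(z_1)=H_\mu(z_2)$. (2) Assume $\mu$ is $\rhd$-infinitely divisible. Then $H_\mu$ (and hence $G_\mu$) is injective on $\mathbb{C}^+$.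
   Context: For a probability measure $\mu$ on $\mathbb{R}$, $G_\mu(z)=\int_{\mathbb{R}}\frac{1}{z-x}\,d\mu(x)$ for $z\in\mathbb{C}^+=\{\operatorname{Im}z>0\}$ and $H_\mu=1/G_\mu$. The monotone convolution $\mu\rhd\nu$ is the unique probability measure with $H_{\mu\rhd\nu}=H_\mu\circ H_\nu$; $\mu^{\rhd k}$ denotes the $k$-fold monotone convolution power. $\mu$ is $\rhd$-$n$-divisible if $\mu=\mu_n^{\rhd n}$ for some probability measure $\mu_n$, and $\rhd$-infinitely divisible if it is $\rhd$-$k$-divisible for every integer $k\ge1$. A probability measure has finite variance iff $H_\mu$ admits such a representation with $a\in\mathbb{R}$, $\rho$ positive finite. *)

(* Defs.v *)
From HB Require Import structures.
From mathcomp Require Import all_boot all_order all_algebra.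
From mathcomp Require Import all_classical all_reals all_analysis.
From mathcomp Require Import complex.
Set Implicit Arguments. Unset Strict Implicit. Unset Printing Implicit Defensive.
Import Order.TTheory GRing.Theory Num.Theory.
Import numFieldNormedType.Exports.
Local Open Scope classical_set_scope.
Local Open Scope ring_scope.
Local Open Scope complex_scope.

Definition Cintegral (R : realType) (m : {measure set R -> \bar R})
  (f : R -> R[i]) : R[i] :=
  (Rintegral m setT (fun x => complex.Re (f x)))
    +i* (Rintegral m setT (fun x => complex.Im (f x))).

Definition upper (R : realType) (z : R[i]) : Prop := 0 < complex.Im z.

Definition Gtr (R : realType) (mu : probability R R) (z : R[i]) : R[i] :=
  Cintegral mu (fun x => (z - x%:C)^-1).

Definition Htr (R : realType) (mu : probability R R) (z : R[i]) : R[i] :=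
  (Gtr mu z)^-1.

Definition is_mconv (R : realType) (mu nu lam : probability R R) : Prop :=
  forall z, upper z -> Htr lam z = Htr mu (Htr nu z).

Fixpoint mpow (R : realType) (nu : probability R R) (k : nat)
  (lam : probability R R) : Prop :=
  match k with
  | 0 => False
  | 1 => forall A, measurable A -> lam A = nu A
  | k'.+1 => exists lam' : probability R R, mpow nu k' lam' /\ is_mconv nu lam' lam
  end.

Definition mdivisible (R : realType) (n : nat) (mu : probability R R) : Prop :=
  exists nu : probability R R, mpow nu n mu.

Definition minf_divisible (R : realType) (mu : probability R R) : Prop :=
  forall k, (1 <= k)%N -> mdivisible k mu.

Definition finite_variance (R : realType) (mu : probability R R) : Prop :=
  mu.-integrable setT (fun x => (x ^+ 2)%:E).

Definition Hrepr (R : realType) (mu : probability R R) (a : R)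
  (rho : {finite_measure set R -> \bar R}) : Prop :=
  forall z, upper z ->
    Htr mu z = a%:C + z + Cintegral rho (fun x => (x%:C - z)^-1).

Definition mass (R : realType) (rho : {finite_measure set R -> \bar R}) : R :=
  fine (rho setT).

(* Main.v *)
(* For every probability measure [nu] the map [F z = H_nu z - z] satisfies the
   Schwarz-Pick inequality
     |F z - F w|^2 <= |z - w|^2 * (Im (F z) / Im z) * (Im (F w) / Im w),
   which is the positivity of a 2x2 Pick matrix;
   no integral representation of [H_nu] is needed.  If [H_mu] is the n-th
   iterate of [H_nu], apply it between a fixed [z] and the orbit of [iY] under
   [H_nu]: as [Y] tends to infinity, each orbit step contributes at least
   [Im z * Im (F z)] to [Y * (Im (H_mu (iY)) - Y) <= rho(R)], so that
   [Im z * Im (F z) <= rho(R) / n] for all [z].  Schwarz-Pick then gives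
   [H_nu z <> H_nu w] when [Im z * Im w > rho(R) / n], and this persists along
   orbits because [Im] does not decrease.
   Optimality is attained by the monotone powers of the symmetric Bernoulli law,
   [H_nu z = z - 1/z], at [z1 = 2i] and [z2 = i/2]. *)
Require Import Defs.
From HB Require Import structures.
From mathcomp Require Import all_boot all_order all_algebra.
From mathcomp Require Import all_classical all_reals all_analysis.
From mathcomp Require Import complex.
From mathcomp Require Import measurable_realfun ring lra.
Set Implicit Arguments. Unset Strict Implicit. Unset Printing Implicit Defensive.
Import Order.TTheory GRing.Theory Num.Theory.
Import numFieldNormedType.Exports.
Local Open Scope classical_set_scope.
Local Open Scope ring_scope.
Local Open Scope complex_scope.

(** * Real-valued squared modulus and the resolvent kernel [1/(z - x)] *)

Definition sqn (R : realType) (z : R[i]) : R :=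
  complex.Re z ^+ 2 + complex.Im z ^+ 2.

Lemma sqn_ge0 (R : realType) (z : R[i]) : 0 <= sqn z.
Proof. by rewrite addr_ge0 ?sqr_ge0. Qed.

Lemma sqn_gt0 (R : realType) (z : R[i]) : z != 0 -> 0 < sqn z.
Proof.
case: z => a b z0; rewrite lt0r sqn_ge0 andbT /sqn /=.
by rewrite paddr_eq0 ?sqr_ge0// !sqrf_eq0; move: z0; rewrite eq_complex.
Qed.

Lemma sqnM (R : realType) (z w : R[i]) : sqn (z * w) = sqn z * sqn w.
Proof. by case: z => a b; case: w => c d; rewrite /sqn /=; ring. Qed.

Lemma sqnV (R : realType) (z : R[i]) : sqn z^-1 = (sqn z)^-1.
Proof.
have [->|z0] := eqVneq z 0; first by rewrite invr0 /sqn /= expr0n addr0 invr0.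
have s0 := lt0r_neq0 (sqn_gt0 z0).
apply: (mulfI s0); rewrite -sqnM !divff// /sqn /=; ring.
Qed.

Lemma Im_inv (R : realType) (z : R[i]) :
  complex.Im z^-1 = - complex.Im z / sqn z.
Proof. by case: z => a b; rewrite /sqn /= mulNr. Qed.

Lemma upper_kernel_neq0 (R : realType) (z : R[i]) (x : R) :
  upper z -> z - x%:C != 0.
Proof.
case: z => a b; rewrite /upper /= => b0.
by rewrite eq_complex /= oppr0 addr0 negb_and (gt_eqF b0) orbT.
Qed.

(** For real [x], [Im (z - x) = Im z]; this makes the squared modulus of the kernel real-linear in
    the kernel, so it can be integrated against a measure. *)
Lemma sqn_kernel (R : realType) (z : R[i]) (x : R) : upper z ->
  sqn (z - x%:C)^-1 = - complex.Im (z - x%:C)^-1 / complex.Im z.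
Proof.
move=> z0; have s0 := lt0r_neq0 (sqn_gt0 (upper_kernel_neq0 x z0)).
rewrite sqnV Im_inv; case: z z0 s0 => a b; rewrite /upper/= => b0 s0.
by rewrite oppr0 addr0; field; rewrite s0 (gt_eqF b0).
Qed.

(** Conjugating [v] makes the cross term the plain product [u * v], to which the resolvent identity
    applies. *)
Lemma sqn_subJ (R : realType) (l u v : R[i]) :
  sqn (u - l * v^*) = sqn u + sqn l * sqn v - 2 * complex.Re (l^* * (u * v)).
Proof.
by case: l => a b; case: u => c d; case: v => e f; rewrite /sqn/=; ring.
Qed.

Lemma Re_add (R : realType) (u v : R[i]) :
  complex.Re (u + v) = complex.Re u + complex.Re v.
Proof. by case: u; case: v. Qed.

Lemma Re_mul_real (R : realType) (k : R) (v : R[i]) :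
  complex.Re (k%:C * v) = k * complex.Re v.
Proof. by case: v => a b /=; rewrite mul0r subr0. Qed.

(* The 2x2 Nevanlinna-Pick positivity for the kernels [f_j = 1/(z_j - x)]: the
   squared norm of [(f1/G1 - 1) - l (f2/G2 - 1)^*] is real-affine in [(f1, f2)]
   because [|f_j|^2 = - Im f_j / Im z_j] and [f1 f2 = (f2 - f1)/(z1 - z2)]. *)
Lemma pick_of_positivity (R : realType) (z1 z2 G1 G2 l : R[i]) :
  upper z1 -> upper z2 -> z1 != z2 -> G1 != 0 -> G2 != 0 ->
  (forall c b1 b2 : R[i],
     (forall x : R, 0 <= complex.Re (c + b1 * (z1 - x%:C)^-1
                                       + b2 * (z2 - x%:C)^-1)) ->
     0 <= complex.Re (c + b1 * G1 + b2 * G2)) ->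
  0 <= (complex.Im G1^-1 / complex.Im z1 - 1)
     + sqn l * (complex.Im G2^-1 / complex.Im z2 - 1)
     - 2 * complex.Re (l^* * ((G1^-1 - G2^-1) / (z1 - z2) - 1)).
Proof.
move=> uz1 uz2 z12 G10 G20 pos.
have dz0 : z1 - z2 != 0 by rewrite subr_eq0.
have y1 : complex.Im z1 != 0 by rewrite gt_eqF.
have y2 : complex.Im z2 != 0 by rewrite gt_eqF.
have s1 := lt0r_neq0 (sqn_gt0 G10).
have s2 := lt0r_neq0 (sqn_gt0 G20).
pose k1 : R := (complex.Im z1 * sqn G1)^-1.
pose k2 : R := (complex.Im z2 * sqn G2)^-1.
(* The real part of [q] is [|f/G - 1|^2] at a kernel [g = f], and the diagonal Pick entry
   [Im (1/G) / Im z - 1] at [g = G]. *)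
pose q k (G g : R[i]) : R[i] := k%:C * ('i * g) - 2%:R%:C * (g / G) + 1.
(* The affine form of [(g1/G1 - 1) * (g2/G2 - 1)]: equal to it at the kernels, and to the
   off-diagonal Pick entry at [G1], [G2]. *)
pose c12 g1 g2 : R[i] := (g2 - g1) / ((z1 - z2) * G1 * G2)
   - g1 / G1 - g2 / G2 + 1.
have split g1 g2 :
   (1 + (sqn l)%:C - 2%:R%:C * l^*)
   + (k1%:C * 'i - 2%:R%:C / G1
       + 2%:R%:C * l^* * (((z1 - z2) * G1 * G2)^-1 + G1^-1)) * g1
   + ((sqn l)%:C * (k2%:C * 'i - 2%:R%:C / G2)
       - 2%:R%:C * l^* * (((z1 - z2) * G1 * G2)^-1 - G2^-1)) * g2
   = q k1 G1 g1 + (sqn l)%:C * q k2 G2 g2 + (- 2)%:C * (l^* * c12 g1 g2).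
  rewrite /q /c12 (rmorphN (real_complex R)).
  move: (((z1 - z2) * G1 * G2)^-1) (G1^-1) (G2^-1) => ? ? ?.
  by ring.
have Req k G g : complex.Re (q k G g)
    = - k * complex.Im g - 2 * complex.Re (g / G) + 1.
  rewrite /q -addrA 2!Re_add -mulNr -(rmorphN (real_complex R)) !Re_mul_real.
  have -> : complex.Re ('i * g) = - complex.Im g.
    by case: g => a b /=; rewrite mul0r mul1r sub0r.
  by rewrite /=; ring.
have pos' := pos (1 + (sqn l)%:C - 2%:R%:C * l^*)
  (k1%:C * 'i - 2%:R%:C / G1
       + 2%:R%:C * l^* * (((z1 - z2) * G1 * G2)^-1 + G1^-1))
  ((sqn l)%:C * (k2%:C * 'i - 2%:R%:C / G2)
       - 2%:R%:C * l^* * (((z1 - z2) * G1 * G2)^-1 - G2^-1)).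
rewrite split in pos'.
have {}pos' : 0 <= complex.Re (q k1 G1 G1 + (sqn l)%:C * q k2 G2 G2
    + (- 2)%:C * (l^* * c12 G1 G2)).
  apply: pos' => x; rewrite split.
  have n1 := upper_kernel_neq0 x uz1.
  have n2 := upper_kernel_neq0 x uz2.
  have sq1 := sqn_kernel x uz1; have sq2 := sqn_kernel x uz2.
  set f1 := (z1 - x%:C)^-1 in sq1 *; set f2 := (z2 - x%:C)^-1 in sq2 *.
  have -> : c12 f1 f2 = (f1 / G1 - 1) * (f2 / G2 - 1).
    (* The resolvent identity. *)
    have f12 : f2 - f1 = f1 * f2 * (z1 - z2).
      by rewrite /f1 /f2; field; rewrite n1 n2.
    by rewrite /c12 f12; field; rewrite dz0 G10 G20.
  have sqnB1 (w : R[i]) : sqn (w - 1) = sqn w - 2 * complex.Re w + 1.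
    by case: w => a b; rewrite /sqn/=; ring.
  have e1 : complex.Re (q k1 G1 f1) = sqn (f1 / G1 - 1).
    rewrite Req sqnB1 sqnM sqnV sq1 /k1; congr (_ - _ + _).
    by field; rewrite s1 y1.
  have e2 : complex.Re (q k2 G2 f2) = sqn (f2 / G2 - 1).
    rewrite Req sqnB1 sqnM sqnV sq2 /k2; congr (_ - _ + _).
    by field; rewrite s2 y2.
  by rewrite 2!Re_add 2!Re_mul_real e1 e2 mulNr -sqn_subJ sqn_ge0.
rewrite 2!Re_add 2!Re_mul_real !Req !divff// in pos'.
have c12E : c12 G1 G2 = (G1^-1 - G2^-1) / (z1 - z2) - 1.
  by rewrite /c12; field; rewrite dz0 G10 G20.
rewrite c12E in pos'; move: pos'.
suff [-> ->] : complex.Im G1^-1 / complex.Im z1 - 1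
     = - k1 * complex.Im G1 - 2 * complex.Re (1 : R[i]) + 1
   /\ complex.Im G2^-1 / complex.Im z2 - 1
     = - k2 * complex.Im G2 - 2 * complex.Re (1 : R[i]) + 1 by rewrite !mulNr.
have r1 : complex.Re (1 : R[i]) = 1 by [].
by rewrite r1 !Im_inv /k1 /k2; split; field; rewrite ?s1 ?s2 ?y1 ?y2.
Qed.

(** With [F z = H z - z], the two factors on the right are [Im (F z) / Im z] and [Im (F w) / Im w],
    and the left side is the squared modulus of the difference quotient of [F]. *)
Definition schwarz_pick (R : realType) (H : R[i] -> R[i]) : Prop :=
  (forall z, upper z -> complex.Im z <= complex.Im (H z)) /\
  (forall z w, upper z -> upper w -> z != w ->
     sqn ((H z - H w) / (z - w) - 1) <=
     (complex.Im (H z) / complex.Im z - 1) *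
     (complex.Im (H w) / complex.Im w - 1)).

(** For [b > 0] the minimum is at [t = 1/b]. For [b = 0] the form is affine in [t] with slope
    [-2 s], which forces [s = 0]. *)
Lemma quadratic_nonneg_discr (R : realFieldType) (a b s : R) :
  0 <= a -> 0 <= b -> 0 <= s ->
  (forall t, 0 <= a + t ^+ 2 * s * b - 2 * t * s) -> s <= a * b.
Proof.
move=> a0 b0 s0 h; have [bz|bn0] := eqVneq b 0.
  have [->|sn0] := eqVneq s 0; first by rewrite mulr_ge0.
  have := h ((a + 1) / s); rewrite bz mulr0 addr0.
  have -> : 2 * ((a + 1) / s) * s = 2 * (a + 1) by field.
  by move=> ?; lra.
have := h b^-1.
have -> : a + b^-1 ^+ 2 * s * b - 2 * b^-1 * s = (a * b - s) / b by field.
have bp : 0 < b by rewrite lt0r bn0.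
by rewrite pmulr_lge0 ?invr_gt0// subr_ge0.
Qed.

(** * Measurability, bounds and integrability of the kernel *)

Section pick_kernel.
Variable R : realType.
Implicit Types (z : R[i]).

Lemma measurable_Re_kernel z : upper z ->
  measurable_fun [set: R] (fun x : R => complex.Re (z - x%:C)^-1).
Proof.
case: z => a b; rewrite /upper /= => b0.
apply: continuous_measurable_fun => x.
have n0 : (a - x) ^+ 2 + (b - 0) ^+ 2 != 0.
  by rewrite gt_eqF// ltr_wpDl ?sqr_ge0// subr0 exprn_gt0.
apply: cvgM; first by apply: cvgB; [exact: cvg_cst|exact: cvg_id].
apply: cvgV => //; apply: cvgD; last exact: cvg_cst.
by apply: cvgM; apply: cvgB; [exact: cvg_cst|exact: cvg_id|exact: cvg_cst|exact: cvg_id].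
Qed.

Lemma measurable_Im_kernel z : upper z ->
  measurable_fun [set: R] (fun x : R => complex.Im (z - x%:C)^-1).
Proof.
case: z => a b; rewrite /upper /= => b0.
apply: continuous_measurable_fun => x.
have n0 : (a - x) ^+ 2 + (b - 0) ^+ 2 != 0.
  by rewrite gt_eqF// ltr_wpDl ?sqr_ge0// subr0 exprn_gt0.
apply: cvgN; apply: cvgM; first exact: cvg_cst.
apply: cvgV => //; apply: cvgD; last exact: cvg_cst.
by apply: cvgM; apply: cvgB; [exact: cvg_cst|exact: cvg_id|exact: cvg_cst|exact: cvg_id].
Qed.

Lemma sqn_kernel_le z (x : R) : upper z ->
  sqn (z - x%:C)^-1 <= (complex.Im z)^-1 ^+ 2.
Proof.
move=> z0; have := sqn_gt0 (upper_kernel_neq0 x z0); rewrite sqnV.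
case: z z0 => a b; rewrite /upper/= => b0 s0.
rewrite exprVn lef_pV2 ?posrE ?exprn_gt0// /sqn/= oppr0 addr0.
by rewrite lerDr sqr_ge0.
Qed.

Lemma norm_Re_kernel_le z (x : R) : upper z ->
  `|complex.Re (z - x%:C)^-1| <= (complex.Im z)^-1.
Proof.
move=> z0; have y0 : 0 <= complex.Im z by exact: ltW.
rewrite -(ler_pXn2r (n := 2))// ?nnegrE ?invr_ge0//.
by apply: (le_trans _ (sqn_kernel_le x z0)); rewrite real_normK ?num_real// lerDl sqr_ge0.
Qed.

Lemma norm_Im_kernel_le z (x : R) : upper z ->
  `|complex.Im (z - x%:C)^-1| <= (complex.Im z)^-1.
Proof.
move=> z0; have y0 : 0 <= complex.Im z by exact: ltW.
rewrite -(ler_pXn2r (n := 2))// ?nnegrE ?invr_ge0//.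
by apply: (le_trans _ (sqn_kernel_le x z0)); rewrite real_normK ?num_real// lerDr sqr_ge0.
Qed.

Variable m : {finite_measure set R -> \bar R}.

Lemma bounded_integrable (f : R -> R) (M : R) :
  measurable_fun [set: R] f -> (forall x, `|f x| <= M) ->
  m.-integrable setT (EFin \o f).
Proof.
move=> mf fM; apply: measurable_bounded_integrable => //.
  by rewrite -ge0_fin_numE ?fin_num_measure.
exists M; split; first exact: num_real.
by move=> K MK x _ /=; exact: le_trans (fM x) (ltW MK).
Qed.

Lemma integrable_linear (f g : R -> R) (p q : R) :
  m.-integrable setT (EFin \o f) -> m.-integrable setT (EFin \o g) ->
  m.-integrable setT (EFin \o (fun x => p * f x + q * g x)).
Proof.
move=> mf mg; have := integrableD measurableT
  (integrableZl measurableT p mf) (integrableZl measurableT q mg).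
by apply: eq_integrable.
Qed.

Lemma Rintegral_linear (f g : R -> R) (p q : R) :
  m.-integrable setT (EFin \o f) -> m.-integrable setT (EFin \o g) ->
  Rintegral m setT (fun x => p * f x + q * g x) =
  p * Rintegral m setT f + q * Rintegral m setT g.
Proof.
move=> mf mg; rewrite RintegralD// ?RintegralZl//.
  exact: (integrableZl measurableT p mf).
exact: (integrableZl measurableT q mg).
Qed.

Lemma integrable_Re_kernel z : upper z ->
  m.-integrable setT (EFin \o (fun x : R => complex.Re (z - x%:C)^-1)).
Proof.
move=> z0; apply: bounded_integrable (measurable_Re_kernel z0) _ => x.
exact: norm_Re_kernel_le.
Qed.

Lemma integrable_Im_kernel z : upper z ->
  m.-integrable setT (EFin \o (fun x : R => complex.Im (z - x%:C)^-1)).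
Proof.
move=> z0; apply: bounded_integrable (measurable_Im_kernel z0) _ => x.
exact: norm_Im_kernel_le.
Qed.

End pick_kernel.

(** * Cauchy transforms of probability measures satisfy Schwarz-Pick *)

Section cauchy_transform.
Variables (R : realType) (mu : probability R R).

(** Integrate the pointwise inequality; total mass one reproduces the constant [c]. *)
Lemma Gtr_positivity (z1 z2 c b1 b2 : R[i]) : upper z1 -> upper z2 ->
  (forall x : R, 0 <= complex.Re (c + b1 * (z1 - x%:C)^-1
                                    + b2 * (z2 - x%:C)^-1)) ->
  0 <= complex.Re (c + b1 * Gtr mu z1 + b2 * Gtr mu z2).
Proof.
move=> uz1 uz2 pos.
pose lin (p : R[i]) (b : R[i]) : R :=
  complex.Re b * complex.Re p + - complex.Im b * complex.Im p.
have linE (p b : R[i]) : complex.Re (b * p) = lin p b.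
  by case: p => ? ?; case: b => ? ? /=; rewrite /lin /= mulNr.
have int_lin (z b : R[i]) (uz : upper z) :=
  integrable_linear (complex.Re b) (- complex.Im b)
    (integrable_Re_kernel mu uz) (integrable_Im_kernel mu uz).
have Rlin (z b : R[i]) (uz : upper z) : lin (Gtr mu z) b = _ :=
  esym (Rintegral_linear (complex.Re b) (- complex.Im b)
    (integrable_Re_kernel mu uz) (integrable_Im_kernel mu uz)).
have c0 : mu.-integrable setT (EFin \o (fun=> complex.Re c)).
  exact: finite_measure_integrable_cst.
have int12 := integrable_linear 1 1 (int_lin z1 b1 uz1) (int_lin z2 b2 uz2).
have R12 := Rintegral_linear 1 1 (int_lin z1 b1 uz1) (int_lin z2 b2 uz2).
have Rc : Rintegral mu setT (fun=> complex.Re c) = complex.Re c.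
  by rewrite Rintegral_cst// -[fine _]/(fine (mu setT)) probability_setT mulr1.
have := Rintegral_linear 1 1 c0 int12.
rewrite R12 {}Rc !mul1r -(Rlin _ _ uz1) -(Rlin _ _ uz2).
rewrite -2!linE addrA -!Re_add.
move=> <-.
apply: Rintegral_ge0 => x _; have := pos x.
by rewrite 2!Re_add !linE /lin !mul1r -addrA.
Qed.

Lemma Im_Gtr_lt0 (z : R[i]) : upper z -> complex.Im (Gtr mu z) < 0.
Proof.
move=> uz.
pose g (x : R) := - complex.Im (z - x%:C)^-1.
have g_gt0 x : 0 < g x.
  rewrite /g -(pmulr_lgt0 _ (_ : 0 < (complex.Im z)^-1)) ?invr_gt0//.
  by rewrite -sqn_kernel// sqn_gt0// invr_eq0 upper_kernel_neq0.
have ig : mu.-integrable setT (EFin \o g).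
  by have := integrableN (integrable_Im_kernel mu uz); apply: eq_integrable.
have Ig : complex.Im (Gtr mu z) = - Rintegral mu setT g.
  have -> : Rintegral mu setT g =
      Rintegral mu setT (fun x => -1 * complex.Im (z - x%:C)^-1).
    by apply: eq_Rintegral => x _; rewrite mulN1r.
  rewrite RintegralZl//; first by rewrite mulN1r opprK.
  exact: integrable_Im_kernel.
have Ig0 : 0 <= Rintegral mu setT g.
  by apply: Rintegral_ge0 => x _; exact/ltW/g_gt0.
rewrite Ig oppr_lt0 lt0r Ig0 andbT.
apply/negP => /eqP I0.
(* A zero integral would make [g] vanish almost everywhere; as [g] is positive everywhere, the whole
   line would be a null set. *)
have /(ae_eq_integral_abs mu measurableT (measurable_int mu ig)) [N [mN N0 sub]] :
    (\int[mu]_x `|(EFin \o g) x| = 0)%E.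
  under eq_integral do rewrite /= ger0_norm ?ltW//.
  have Ifin : (\int[mu]_x (g x)%:E)%E \is a fin_num by exact: integrable_fin_num.
  by rewrite -(fineK Ifin) -[fine _]/(Rintegral mu setT g) I0.
have : (mu setT <= mu N)%E.
  apply: le_measure; rewrite ?inE// => x _; apply: sub => /= h.
  have [gx0] := h Logic.I.
  by move: (g_gt0 x); rewrite gx0 ltxx.
by rewrite probability_setT N0 lee_fin ler10.
Qed.

Lemma Gtr_neq0 (z : R[i]) : upper z -> Gtr mu z != 0.
Proof. by move=> /Im_Gtr_lt0; apply: contraTneq => ->; rewrite ltxx. Qed.

Lemma schwarz_pick_Htr : schwarz_pick (Htr mu).
Proof.
have pickG z w (uz : upper z) (uw : upper w) (zw : z != w) l :=
  @pick_of_positivity R z w _ _ l uz uw zw (Gtr_neq0 uz) (Gtr_neq0 uw)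
       (fun c b1 b2 => @Gtr_positivity z w c b1 b2 uz uw).
(* The multiplier [l = 0] isolates the first diagonal entry. *)
have D0 z w : upper z -> upper w -> z != w ->
    0 <= complex.Im (Htr mu z) / complex.Im z - 1.
  move=> uz uw zw; have := pickG z w uz uw zw 0.
  by rewrite rmorph0 mul0r /sqn/= expr0n addr0 mul0r mulr0 subr0 addr0.
split=> [z uz|z w uz uw zw].
  (* The Pick form is stated for two distinct points, so [z + 1] serves as an auxiliary second
     one. *)
  have uw : upper (z + 1) by case: z uz => a b; rewrite /upper/= addr0.
  have zw : z != z + 1 by rewrite -subr_eq0 opprD addNKr oppr_eq0 oner_eq0.
  by have := D0 _ _ uz uw zw; rewrite subr_ge0 ler_pdivlMr// mul1r.
apply: quadratic_nonneg_discr (D0 _ _ uz uw zw) _ (sqn_ge0 _) _.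
  by apply: D0 uw uz _; rewrite eq_sym.
(* The multiplier [l = t * c] aligns the phase, leaving a quadratic in the real variable [t] with
   [s = |c|^2]. *)
set c := (Htr mu z - Htr mu w) / (z - w) - 1 => t; have := pickG z w uz uw zw (t%:C * c).
rewrite -/(Htr mu z) -/(Htr mu w) -/c sqnM.
have -> : sqn t%:C = t ^+ 2 by rewrite /sqn/= expr0n addr0.
have -> : complex.Re ((t%:C * c)^* * c) = t * sqn c.
  by case: (c) => a b; rewrite /sqn /=; ring.
by rewrite mulrA.
Qed.

End cauchy_transform.

(** * Iterates of a map satisfying Schwarz-Pick *)

Section iterated_root.
Variables (R : realType) (H : R[i] -> R[i]).
Hypothesis spH : schwarz_pick H.

Lemma upper_iter (n : nat) (z : R[i]) : upper z -> upper (iter n H z).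
Proof.
move=> uz; elim: n => //= n IH.
exact: lt_le_trans IH (proj1 spH _ IH).
Qed.

Lemma Im_iter_ge (n : nat) (z : R[i]) :
  upper z -> complex.Im z <= complex.Im (iter n H z).
Proof.
move=> uz; elim: n => //= n IH; apply: le_trans IH _.
by exact: (proj1 spH _ (upper_iter n uz)).
Qed.

(** The inequality with denominators cleared, so that it also covers [z = w]. *)
Lemma schwarz_pick_displacement (z w : R[i]) : upper z -> upper w ->
  sqn ((H z - z) - (H w - w)) * (complex.Im z * complex.Im w) <=
  sqn (z - w) * ((complex.Im (H z) - complex.Im z) *
                 (complex.Im (H w) - complex.Im w)).
Proof.
move=> uz uw; have [->|zw] := eqVneq z w.
  have s0 : sqn (0 : R[i]) = 0 by rewrite /sqn/= expr0n addr0.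
  by rewrite !subrr s0 !mul0r.
have d0 : z - w != 0 by rewrite subr_eq0.
have -> : (H z - z) - (H w - w) = ((H z - H w) / (z - w) - 1) * (z - w).
  by field.
rewrite sqnM [_ * sqn (z - w)]mulrC -mulrA ler_wpM2l ?sqn_ge0//.
have y1 : 0 < complex.Im z by []; have y2 : 0 < complex.Im w by [].
have -> : (complex.Im (H z) - complex.Im z) * (complex.Im (H w) - complex.Im w)
    = (complex.Im (H z) / complex.Im z - 1) *
      (complex.Im (H w) / complex.Im w - 1) * (complex.Im z * complex.Im w).
  by field; rewrite !gt_eqF.
by rewrite ler_wpM2r ?mulr_ge0 ?(ltW y1) ?(ltW y2)//; exact: (proj2 spH).
Qed.

(** If [H z = H w], the displacements differ by [-(z - w)], so [Im z * Im w] is at most the product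
    of their imaginary parts. Multiplying by [Im z * Im w] gives [(Im z * Im w)^2 <= s^2], a
    contradiction. *)
Lemma schwarz_pick_neq (s : R) (z w : R[i]) :
  (forall u, upper u -> complex.Im u * (complex.Im (H u) - complex.Im u) <= s) ->
  upper z -> upper w -> z != w -> s < complex.Im z * complex.Im w ->
  H z != H w.
Proof.
move=> es uz uw zw szw; apply/eqP => Hzw.
have y1 : 0 < complex.Im z by []; have y2 : 0 < complex.Im w by [].
have := schwarz_pick_displacement uz uw.
have -> : (H z - z) - (H w - w) = -1 * (z - w) by rewrite Hzw; ring.
have sq1 : sqn (-1 : R[i]) = 1 by rewrite /sqn/=; ring.
have d0 : 0 < sqn (z - w) by rewrite sqn_gt0// subr_eq0.
rewrite sqnM sq1 mul1r ler_pM2l//.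
have e1 := es z uz; have e2 := es w uw.
have h1 := proj1 spH z uz; have h2 := proj1 spH w uw.
move: e1 e2 h1 h2 szw; rewrite Hzw.
move: (complex.Im z) (complex.Im w) (complex.Im (H w)) y1 y2 => a b c.
move=> a0 b0 e1 e2 h1 h2 sab hab.
have ca : 0 <= a * (c - a) by rewrite mulr_ge0 ?subr_ge0// ltW.
have cb : 0 <= b * (c - b) by rewrite mulr_ge0 ?subr_ge0// ltW.
have ab0 : 0 < a * b by rewrite mulr_gt0.
have : a * (c - a) * (b * (c - b)) <= s * s by rewrite ler_pM.
have -> : a * (c - a) * (b * (c - b)) = a * b * ((c - a) * (c - b)) by ring.
have : a * b * (a * b) <= a * b * ((c - a) * (c - b)) by rewrite ler_pM2l.
have : s * s < a * b * (a * b) by rewrite ltr_pM// (le_trans ca).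
by move=> l1 l2 l3; move: (lt_le_trans l1 (le_trans l2 l3)); rewrite ltxx.
Qed.

Lemma iter_neq (s : R) (n : nat) (z w : R[i]) :
  (forall u, upper u -> complex.Im u * (complex.Im (H u) - complex.Im u) <= s) ->
  upper z -> upper w -> z != w -> s < complex.Im z * complex.Im w ->
  iter n H z != iter n H w.
Proof.
move=> es uz uw zw szw; elim: n => //= n IH.
apply: (schwarz_pick_neq es) => //; try exact: upper_iter.
apply: lt_le_trans szw _.
by rewrite ler_pM ?Im_iter_ge// ltW.
Qed.

(** Replaces a limit [Y -> oo]: if [x > s], the value [Y = Y0 + K / (x - s)] already violates the
    bound. *)
Lemma le_of_le_add_inv (x s K Y0 : R) : 0 < Y0 -> 0 <= K ->
  (forall Y, Y0 <= Y -> x <= s + K / Y) -> x <= s.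
Proof.
move=> Y00 K0 h; rewrite leNgt; apply/negP => sx.
have e0 : 0 < x - s by rewrite subr_gt0.
have Ke : 0 <= K / (x - s) by rewrite divr_ge0// ltW.
have Yp : 0 < Y0 + K / (x - s) by rewrite ltr_wpDr.
have := h (Y0 + K / (x - s)); rewrite lerDl => /(_ Ke).
rewrite -lerBlDl ler_pdivlMr// mulrDr [_ * (K / _)]mulrC divfK ?gt_eqF//.
by rewrite gerDr leNgt mulr_gt0.
Qed.

(** * Growth along the orbit of [iY] controls the displacement everywhere *)

Section growth.
Variables (n : nat) (s : R).
Hypothesis bnd : forall Y : R, 0 < Y -> complex.Im (iter n H (0 +i* Y)) - Y <= s / Y.

Let orb Y k : R[i] := iter k H (0 +i* Y).
Let incr Y k : R := complex.Im (orb Y k.+1) - complex.Im (orb Y k).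

Let upper_orb Y k : 0 < Y -> upper (orb Y k).
Proof. by move=> Y0; exact: upper_iter. Qed.

Let incr_ge0 Y k : 0 < Y -> 0 <= incr Y k.
Proof. by move=> Y0; rewrite subr_ge0; exact/(proj1 spH)/upper_orb. Qed.

Let sum_incr Y m : \sum_(k < m) incr Y k = complex.Im (orb Y m) - Y.
Proof.
elim: m => [|m IH]; first by rewrite big_ord0 /= subrr.
by rewrite big_ord_recr /= IH /incr addrC addrA subrK.
Qed.

Let Im_orb_ge Y k : 0 < Y -> Y <= complex.Im (orb Y k).
Proof. by move=> Y0; apply: (@Im_iter_ge k (0 +i* Y)). Qed.

Let Im_orb_le Y k : 0 < Y -> (k <= n)%N -> complex.Im (orb Y k) - Y <= s / Y.
Proof.
move=> Y0 kn; apply: le_trans (bnd Y0); rewrite lerB//.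
rewrite -(subnK kn) iterD; apply: Im_iter_ge; exact: upper_orb.
Qed.

Let incr_le Y k : 0 < Y -> (k < n)%N -> incr Y k <= s / Y.
Proof.
move=> Y0 kn; apply: le_trans (Im_orb_le Y0 kn).
by rewrite /incr lerB// Im_orb_ge.
Qed.

Let s_ge0 : 0 <= s.
Proof.
have := Im_orb_le (Y := 1) ltr01 (leq0n n).
by rewrite /= subrr divr1.
Qed.

Let div_le Y : 1 <= Y -> s / Y <= s.
Proof.
by move=> Y1; rewrite ler_pdivrMr ?(lt_le_trans ltr01)// ler_peMr.
Qed.

(** Induction on [k]: Schwarz-Pick between the orbit point and [i] bounds the next displacement
    uniformly in [Y], because its imaginary part is [O(1/Y)] while the orbit point is [O(Y)]. *)
Let Re_orb_bounded k : (k <= n)%N ->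
  exists2 C : R, 0 <= C & forall Y, 1 <= Y -> `|complex.Re (orb Y k)| <= C.
Proof.
elim: k => [_|k IH kn]; first by exists 0 => // Y _; rewrite /= normr0.
have [C C0 hC] := IH (ltnW kn).
pose i1 : R[i] := 0 +i* 1.
have ui : upper i1 by rewrite /upper/=.
have [p0 p00 p0E] : exists2 p0 : R, 0 <= p0 & complex.Im (H i1) - 1 = p0.
  by exists (complex.Im (H i1) - 1); rewrite // subr_ge0; exact: (proj1 spH _ ui).
(* Bounds [|u|^2] below: [|w - i|^2 <= (C^2 + 1) (Im w)^2], the increment is at most [s / Y], and
   [Im w / Y <= 1 + s]. *)
pose M := (C ^+ 2 + 1) * p0 * s * (1 + s).
have M0 : 0 <= M by rewrite !mulr_ge0 ?addr_ge0 ?sqr_ge0.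
exists (C + `|complex.Re (H i1 - i1)| + 1 + M) => [|Y Y1].
  by rewrite !addr_ge0.
have Y0 : 0 < Y := lt_le_trans ltr01 Y1.
have := schwarz_pick_displacement (upper_orb k Y0) ui.
have := hC Y Y1; have := Im_orb_ge k Y0; have := Im_orb_le Y0 (ltnW kn).
have := incr_ge0 k Y0; have := incr_le Y0 kn.
have sY := div_le Y1; have sY0 : 0 <= s / Y by rewrite divr_ge0// ltW.
rewrite /incr -[orb Y k.+1]/(H (orb Y k)).
move: (orb Y k) => w dle d0 vle vge xC.
set d := complex.Im (H w) - _ in dle d0 *.
have -> : complex.Im i1 = 1 by [].
rewrite mulr1 p0E => hsp.
set u := (H w - w) - (H i1 - i1) in hsp.
have Reu : complex.Re (H w) = complex.Re w + complex.Re (H i1 - i1) + complex.Re u.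
  by rewrite -!Re_add /u; congr complex.Re; ring.
have v0 : 0 < complex.Im w by apply: lt_le_trans Y0 _.
have sqw : sqn (w - i1) <= (C ^+ 2 + 1) * complex.Im w ^+ 2.
  have x2 : complex.Re w ^+ 2 <= C ^+ 2.
    by rewrite -(real_normK (num_real (complex.Re w))) ler_pXn2r ?nnegrE.
  have v1 : 1 <= complex.Im w := le_trans Y1 vge.
  rewrite mulrDl mul1r; case: (w) x2 v1 => a b /= x2 v1.
  rewrite /sqn /= subr0 lerD//.
    by apply: (le_trans x2); rewrite ler_peMr ?sqr_ge0// exprn_ege1.
  by rewrite ler_pXn2r ?nnegrE//; lra.
have usq : sqn u <= M.
  rewrite -(ler_pM2r v0); apply: (le_trans hsp).
  have h1 : sqn (w - i1) * (d * p0) <=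
      (C ^+ 2 + 1) * complex.Im w ^+ 2 * (s / Y * p0).
    by rewrite ler_pM ?sqn_ge0// ?mulr_ge0// ler_wpM2r.
  apply: (le_trans h1).
  have vY : complex.Im w / Y <= 1 + s.
    by rewrite ler_pdivrMr// mulrDl mul1r; have := ler_peMr s_ge0 Y1; lra.
  have -> : (C ^+ 2 + 1) * complex.Im w ^+ 2 * (s / Y * p0) =
      (C ^+ 2 + 1) * p0 * s * (complex.Im w / Y) * complex.Im w.
    by field; rewrite gt_eqF.
  rewrite ler_pM2r// /M ler_wpM2l// !mulr_ge0 ?addr_ge0 ?sqr_ge0//.
have uM : `|complex.Re u| <= 1 + M.
  apply: le_trans (_ : 1 + complex.Re u ^+ 2 <= _); last first.
    by rewrite lerD2l; apply: le_trans usq; rewrite lerDl sqr_ge0.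
  rewrite -(real_normK (num_real (complex.Re u))).
  by have := sqr_ge0 (`|complex.Re u| - 1); have := normr_ge0 (complex.Re u); nra.
rewrite Reu -addrA; apply: (le_trans (ler_normD _ _)).
have := ler_normD (complex.Re (H i1 - i1)) (complex.Re u); lra.
Qed.

(* Letting [Y] tend to infinity in the Schwarz-Pick inequality between [z] and
   the orbit points [orb Y k] bounds [Im z * (Im (H z) - Im z)] by the limit of
   [Y * incr Y k]; summing over [k < n] telescopes to [s]. *)
Lemma root_displacement_le (z : R[i]) : upper z ->
  n%:R * (complex.Im z * (complex.Im (H z) - complex.Im z)) <= s.
Proof.
move=> uz.
(* One constant for all steps, obtained by adding the finitely many individual ones. *)
have [C C0 hC] : exists2 C : R, 0 <= C & forall k Y, (k < n)%N -> 1 <= Y ->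
    `|complex.Re (orb Y k)| <= C.
  have : forall m, (m <= n)%N -> exists2 C : R, 0 <= C &
      forall k Y, (k < m)%N -> 1 <= Y -> `|complex.Re (orb Y k)| <= C.
    elim=> [_|m IH mn]; first by exists 0.
    have [C C0 hC] := IH (ltnW mn); have [D D0 hD] := Re_orb_bounded (ltnW mn).
    exists (C + D) => [|k Y]; first by rewrite addr_ge0.
    rewrite ltnS leq_eqVlt => /predU1P[-> Y1|km Y1].
      by apply: (le_trans (hD Y Y1)); rewrite lerDr.
    by apply: (le_trans (hC k Y km Y1)); rewrite lerDl.
  by move/(_ n (leqnn n)).
have y0 : 0 < complex.Im z by [].
set p := complex.Im (H z) - complex.Im z; set y := complex.Im z in y0 p *.
have p0 : 0 <= p by rewrite subr_ge0; exact: (proj1 spH).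
pose E := C + `|complex.Re z|.
have E0 : 0 <= E by rewrite addr_ge0.
(* Chosen so that [2 * y + v + E^2 <= Y + B] for every orbit height [v <= Y + s]. *)
pose B := 2 * y + E ^+ 2 + s.
have B0 : 0 <= B by rewrite !addr_ge0 ?sqr_ge0 ?mulr_ge0// ltW.
(* The error is [B * s / Y] since [s / Y * (Y + B) = s + B * s / Y]; the threshold [1 + y] ensures
   both [Y >= 1] and [Y >= y]. *)
apply: (@le_of_le_add_inv _ _ (B * s) (1 + y)); rewrite ?mulr_ge0 ?addr_gt0//.
move=> Y hY; have Y1 : 1 <= Y by lra.
have Y0 : 0 < Y := lt_le_trans ltr01 Y1.
have yY : y <= Y by lra.
have YB : 0 <= Y + B by apply: addr_ge0 => //; exact: ltW.
have key k : (k < n)%N -> y * p <= incr Y k * (Y + B).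
  move=> kn.
  have [pz|pn0] := eqVneq p 0.
    by rewrite pz mulr0; apply: mulr_ge0 => //; exact: incr_ge0.
  have pp : 0 < p by rewrite lt0r pn0.
  have := schwarz_pick_displacement uz (upper_orb k Y0).
  have := hC k Y kn Y1; have := Im_orb_ge k Y0; have := Im_orb_le Y0 (ltnW kn).
  have := incr_ge0 k Y0; have sY := div_le Y1.
  rewrite /incr -[orb Y k.+1]/(H (orb Y k)) -/p -/y.
  move: (orb Y k) => w.
  set v := complex.Im w; set d := complex.Im (H w) - v => d0 vle vge xC hsp.
  have v0 : 0 < v := lt_le_trans Y0 vge.
  (* From [(p - d)^2 >= p^2 - 2 d p]; the factor [p] then cancels, which is why [p = 0] was split
     off. *)
  have sqF : (p - 2 * d) * p <= sqn ((H z - z) - (H w - w)).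
    have : complex.Im ((H z - z) - (H w - w)) = p - d.
      rewrite /p /d /y /v; case: (z) (w) (H z) (H w) => [? ?] [? ?] [? ?] [? ?] /=.
      by ring.
    move=> Imd; rewrite /sqn Imd.
    by have := sqr_ge0 (complex.Re ((H z - z) - (H w - w))); have := sqr_ge0 d; nra.
  have sqw : sqn (z - w) <= E ^+ 2 + v ^+ 2.
    have Rzw : `|complex.Re (z - w)| <= E.
      have -> : complex.Re (z - w) = - complex.Re w + complex.Re z.
        by case: (z) (w) => ? ? [? ?] /=; ring.
      by apply: (le_trans (ler_normD _ _)); rewrite normrN lerD.
    have Izw : complex.Im (z - w) = y - v by rewrite /y /v; case: (z) (w) => ? ? [].
    rewrite /sqn Izw lerD//.
      by rewrite -(real_normK (num_real (complex.Re _))) ler_pXn2r ?nnegrE.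
    by nra.
  have h1 : (p - 2 * d) * p * (y * v) <= (E ^+ 2 + v ^+ 2) * (p * d).
    apply: (le_trans (ler_wpM2r _ sqF)); first by rewrite mulr_ge0 ?(ltW y0) ?(ltW v0).
    by apply: (le_trans hsp); rewrite ler_wpM2r// mulr_ge0.
  have h2 : (p - 2 * d) * (y * v) <= (E ^+ 2 + v ^+ 2) * d.
    by rewrite -(ler_pM2r pp); move: h1; congr (_ <= _); ring.
  (* Since [v >= 1], the term [E^2 * d] may be multiplied by [v], and then [v] cancels
     throughout. *)
  have h3 : y * p * v <= d * (2 * y + v + E ^+ 2) * v.
    have : E ^+ 2 * d <= E ^+ 2 * d * v.
      by rewrite ler_peMr ?mulr_ge0 ?sqr_ge0//; exact: le_trans Y1 vge.
    by move: h2; nra.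
  move: h3; rewrite ler_pM2r// => h3; apply: (le_trans h3).
  by rewrite ler_wpM2l// /B; lra.
have : \sum_(k < n) (y * p) <= \sum_(k < n) incr Y k * (Y + B).
  by apply: ler_sum => k _; exact: key.
rewrite sumr_const card_ord -mulr_suml sum_incr mulr_natl => h.
apply: (le_trans h); apply: le_trans (_ : s / Y * (Y + B) <= _).
  by rewrite ler_wpM2r//; exact: bnd.
by rewrite mulrDr divfK ?gt_eqF// lerD2l mulrC mulrA.
Qed.

End growth.
End iterated_root.

(** * Injectivity for n-divisible measures *)

Lemma eq_Gtr (R : realType) (mu nu : probability R R) (z : R[i]) :
  (forall A, measurable A -> mu A = nu A) -> Gtr mu z = Gtr nu z.
Proof.
by move=> h; rewrite /Gtr /Cintegral /Rintegral; congr (fine _ +i* fine _);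
  apply: eq_measure_integral => A mA _; exact: h.
Qed.

(** In the recursion [nu] is the left factor, so its transform is composed on the outside, as in
    [iter]. The exponent is a successor because [mpow] is false at 0. *)
Lemma mpow_Htr (R : realType) (nu mu : probability R R) (n : nat) (z : R[i]) :
  mpow nu n.+1 mu -> upper z -> Htr mu z = iter n.+1 (Htr nu) z.
Proof.
elim: n mu => [|n IH] mu /=; first by move=> h _; rewrite /Htr (eq_Gtr z h).
by move=> [lam [plam hconv]] uz; rewrite hconv// (IH lam).
Qed.

(** The real constant [a] drops out of the imaginary part, and the kernel has modulus at most
    [1 / Im z]. *)
Lemma Hrepr_displacement_le (R : realType) (mu : probability R R) (a : R)
  (rho : {finite_measure set R -> \bar R}) (z : R[i]) :
  Hrepr mu a rho -> upper z ->
  complex.Im (Htr mu z) - complex.Im z <= mass rho / complex.Im z.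
Proof.
move=> hr uz; rewrite hr//.
have y0 : 0 < complex.Im z by [].
have kerE (x : R) : complex.Im (x%:C - z)^-1 = -1 * complex.Im (z - x%:C)^-1.
  by rewrite -opprB invrN mulN1r; case: (_^-1).
have ik := integrable_Im_kernel rho uz.
have -> : complex.Im (a%:C + z + Cintegral rho (fun x : R => (x%:C - z)^-1))
    - complex.Im z = Rintegral rho setT (fun x : R => complex.Im (x%:C - z)^-1).
  by case: (z) => b c /=; ring.
have -> : Rintegral rho setT (fun x : R => complex.Im (x%:C - z)^-1) =
    Rintegral rho setT (fun x : R => -1 * complex.Im (z - x%:C)^-1).
  by apply: eq_Rintegral => x _; rewrite kerE.
rewrite RintegralZl// mulN1r; apply: (le_trans (ler_norm _)); rewrite normrN.
apply: (le_trans (le_normr_Rintegral measurableT ik)).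
have -> : mass rho / complex.Im z =
    Rintegral rho setT (fun=> (complex.Im z)^-1).
  by rewrite Rintegral_cst// mulrC.
apply: le_Rintegral => //.
- by have := integrable_norm ik; apply: eq_integrable.
- exact: finite_measure_integrable_cst.
- by move=> x _; exact: norm_Im_kernel_le.
Qed.

Lemma mass_ge0 (R : realType) (rho : {finite_measure set R -> \bar R}) :
  0 <= mass rho.
Proof. exact: fine_ge0. Qed.

Lemma ndivisible_Htr_neq (R : realType) (n : nat) (mu : probability R R) (a : R)
  (rho : {finite_measure set R -> \bar R}) (z1 z2 : R[i]) :
  (1 <= n)%N -> Hrepr mu a rho -> mdivisible n mu ->
  upper z1 -> upper z2 -> z1 != z2 ->
  mass rho / n%:R < complex.Im z1 * complex.Im z2 -> Htr mu z1 != Htr mu z2.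
Proof.
case: n => // n _ hr [nu pnu] u1 u2 z12 hlt.
rewrite !(mpow_Htr pnu)//.
apply: (iter_neq (schwarz_pick_Htr nu) _ _ u1 u2 z12 hlt).
move=> u uu; rewrite ler_pdivlMr ?ltr0Sn// mulrC.
apply: (root_displacement_le (schwarz_pick_Htr nu)) => // Y Y0.
have uY : upper (0 +i* Y) by [].
rewrite -(mpow_Htr pnu)//.
exact: Hrepr_displacement_le hr uY.
Qed.

(** * Measures with finitely many atoms *)

Section measure_of_finite_mass.
Variables (R : realType) (m : {measure set R -> \bar R}).

(** An alias of [m] indexed by the finiteness proof, to which the finite-measure structure can be
    attached; [probability_copy] does the same for total mass one. *)
Definition finite_copy of fin_num_fun m : set R -> \bar R := m.

HB.instance Definition _ (h : fin_num_fun m) := Measure.on (finite_copy h).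
HB.instance Definition _ (h : fin_num_fun m) :=
  Measure_isFinite.Build _ _ _ (finite_copy h) h.

Definition probability_copy of m setT = 1%E : set R -> \bar R := m.

HB.instance Definition _ (h : m setT = 1%E) := Measure.on (probability_copy h).
HB.instance Definition _ (h : m setT = 1%E) :=
  Measure_isProbability.Build _ _ _ (probability_copy h) h.

End measure_of_finite_mass.

Section atomic_measure.
Variable R : realType.
Implicit Types (s : seq (R * R)).

Definition nonneg_weights s : bool := all (fun p => 0 <= p.1) s.

Definition total_weight s : R := \sum_(p <- s) p.1.

(* [s] lists pairs (weight, atom). *)
Definition atomic s (m : {measure set R -> \bar R}) : Prop :=
  forall f : R -> R, measurable_fun [set: R] f ->
    m.-integrable setT (EFin \o f) /\
    Rintegral m setT f = \sum_(p <- s) p.1 * f p.2.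

(** The formula for [|f|] gives integrability; the one for [f] follows from its positive and
    negative parts. *)
Lemma atomic_of_nonneg s (m : {measure set R -> \bar R}) :
  (forall f : R -> R, measurable_fun [set: R] f -> (forall x, 0 <= f x) ->
     (\int[m]_x (f x)%:E = (\sum_(p <- s) p.1 * f p.2)%:E)%E) ->
  atomic s m.
Proof.
move=> h f mf.
have imf : m.-integrable setT (EFin \o f).
  apply/integrableP; split; first exact/measurable_EFinP.
  have := h (fun x => `|f x|) (measurableT_comp (@normr_measurable R setT) mf).
  by move=> /(_ (fun=> normr_ge0 _)) ->; rewrite ltry.
split=> //.
have mp := measurable_funrpos mf; have mn := measurable_funrneg mf.
have fE x : f x = f^\+ x - f^\- x by rewrite -[in LHS](funrposBneg f).
have -> : Rintegral m setT f = Rintegral m setT (fun x => f^\+ x - f^\- x).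
  by apply: eq_Rintegral => x _; exact: fE.
rewrite RintegralB//; last 2 first.
- exact: integrable_funrpos.
- exact: integrable_funrneg.
rewrite /Rintegral !h//= -sumrB; apply: eq_bigr => p _.
by rewrite -mulrBr -fE.
Qed.

(** A sum of scaled Dirac masses, built along the list; its total mass is read off from [f = 1]. *)
Lemma exists_atomic s : nonneg_weights s ->
  exists m : {measure set R -> \bar R}, atomic s m /\ m setT = (total_weight s)%:E.
Proof.
move=> s0.
suff [m hm] : exists m : {measure set R -> \bar R},
    forall f : R -> R, measurable_fun [set: R] f -> (forall x, 0 <= f x) ->
     (\int[m]_x (f x)%:E = (\sum_(p <- s) p.1 * f p.2)%:E)%E.
  exists m; split; first exact: atomic_of_nonneg.
  have mc : measurable_fun [set: R] (fun=> 1 : R) by exact: measurable_cst.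
  have := hm _ mc (fun=> ler01).
  rewrite integral_cst// mul1e => ->; congr (_%:E).
  by apply: eq_bigr => p _; rewrite mulr1.
elim: s s0 => [_|[k w] s IH /=]; last move=> /andP[/= k0 /IH[m hm]].
  by exists mzero => f _ _; rewrite integral_measure_zero big_nil.
exists (measure_add (mscale (NngNum k0) \d_w) m) => f mf f0.
have mEf : measurable_fun [set: R] (EFin \o f) by exact/measurable_EFinP.
have f0' x : [set: R] x -> (0 <= (f x)%:E)%E by rewrite lee_fin.
rewrite ge0_integral_measure_add// ge0_integral_mscale// integral_dirac//.
by rewrite hm// diracT mul1e big_cons -EFinM -EFinD.
Qed.

Lemma exists_finite_atomic s : nonneg_weights s ->
  exists m : {finite_measure set R -> \bar R},
    atomic s m /\ mass m = total_weight s.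
Proof.
move=> /exists_atomic[m [am mT]].
have fin : fin_num_fun m.
  move=> A mA; rewrite ge0_fin_numE//.
  have mTy : (m setT < +oo)%E by rewrite mT ltry.
  by apply: le_lt_trans mTy; apply: le_measure; rewrite ?inE.
exists (finite_copy fin); split; first exact: am.
by rewrite /mass /= mT.
Qed.

Lemma exists_probability_atomic s : nonneg_weights s -> total_weight s = 1 ->
  exists m : probability R R, atomic s m.
Proof.
move=> /exists_atomic[m [am mT]] s1; rewrite s1 in mT.
by exists (probability_copy mT); exact: am.
Qed.

Definition cauchy_sum s (z : R[i]) : R[i] :=
  \sum_(p <- s) p.1%:C / (z - p.2%:C).

Lemma Re_cauchy_sum s z : complex.Re (cauchy_sum s z) =
  \sum_(p <- s) p.1 * complex.Re (z - p.2%:C)^-1.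
Proof.
rewrite /cauchy_sum (big_morph (@complex.Re R) (@Re_add R) erefl).
by apply: eq_bigr => p _; rewrite Re_mul_real.
Qed.

Lemma Im_cauchy_sum s z : complex.Im (cauchy_sum s z) =
  \sum_(p <- s) p.1 * complex.Im (z - p.2%:C)^-1.
Proof.
have ImD (u v : R[i]) : complex.Im (u + v) = complex.Im u + complex.Im v.
  by case: u; case: v.
rewrite /cauchy_sum (big_morph (@complex.Im R) ImD erefl).
by apply: eq_bigr => p _; case: (_^-1) => a b /=; rewrite mul0r addr0.
Qed.

Lemma Cintegral_atomic s (m : {measure set R -> \bar R}) (z : R[i]) :
  atomic s m -> upper z ->
  Cintegral m (fun x => (z - x%:C)^-1) = cauchy_sum s z.
Proof.
move=> am uz; rewrite /Cintegral.
rewrite (am _ (measurable_Re_kernel uz)).2 (am _ (measurable_Im_kernel uz)).2.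
rewrite -Re_cauchy_sum -Im_cauchy_sum; by case: (cauchy_sum s z).
Qed.

Lemma Cintegral_atomic_opp s (m : {measure set R -> \bar R}) (z : R[i]) :
  atomic s m -> upper z ->
  Cintegral m (fun x => (x%:C - z)^-1) = - cauchy_sum s z.
Proof.
move=> am uz; rewrite /Cintegral.
have kerE (x : R) : (x%:C - z)^-1 = - (z - x%:C)^-1 by rewrite -opprB invrN.
have mr : measurable_fun [set: R] (fun x : R => complex.Re (x%:C - z)^-1).
  have -> : (fun x : R => complex.Re (x%:C - z)^-1) =
      (fun x : R => - complex.Re (z - x%:C)^-1).
    by apply/funext => x; rewrite kerE; case: (_^-1).
  by apply: measurableT_comp => //; exact: measurable_Re_kernel.
have mi : measurable_fun [set: R] (fun x : R => complex.Im (x%:C - z)^-1).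
  have -> : (fun x : R => complex.Im (x%:C - z)^-1) =
      (fun x : R => - complex.Im (z - x%:C)^-1).
    by apply/funext => x; rewrite kerE; case: (_^-1).
  by apply: measurableT_comp => //; exact: measurable_Im_kernel.
rewrite (am _ mr).2 (am _ mi).2.
have -> : \sum_(p <- s) p.1 * complex.Re (p.2%:C - z)^-1 =
    - complex.Re (cauchy_sum s z).
  rewrite Re_cauchy_sum -sumrN; apply: eq_bigr => p _.
  by rewrite kerE; case: (_^-1) => a b /=; rewrite mulrN.
have -> : \sum_(p <- s) p.1 * complex.Im (p.2%:C - z)^-1 =
    - complex.Im (cauchy_sum s z).
  rewrite Im_cauchy_sum -sumrN; apply: eq_bigr => p _.
  by rewrite kerE; case: (_^-1) => a b /=; rewrite mulrN.
by case: (cauchy_sum s z).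
Qed.

End atomic_measure.

(** * Monotone powers of the symmetric Bernoulli law *)

Section bernoulli_powers.
Variable R : realType.
Implicit Types (s : seq (R * R)) (z : R[i]).

(* The reciprocal Cauchy transform of the symmetric Bernoulli law. *)
Definition joukowski z : R[i] := z - z^-1.

Definition root_plus (w : R) : R := (w + Num.sqrt (w ^+ 2 + 4)) / 2.
Definition root_minus (w : R) : R := (w - Num.sqrt (w ^+ 2 + 4)) / 2.
Definition root_gap (w : R) : R := root_plus w - root_minus w.

(* Atoms of the measure with Cauchy transform [G (z - 1/z)]: the equation
   [z - 1/z = w] has the real roots [root_plus w] and [root_minus w], and the
   weights are the residues of [1/(z - 1/z - w)] there. *)
Definition pullback s : seq (R * R) := flatten
  [seq [:: (p.1 * (root_plus p.2 / root_gap p.2), root_plus p.2);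
           (p.1 * (- root_minus p.2 / root_gap p.2), root_minus p.2)] | p <- s].

Lemma sqrt_gt_norm (w : R) : `|w| < Num.sqrt (w ^+ 2 + 4).
Proof.
rewrite -sqrtr_sqr ltr_sqrt ?ltrDl// ltr_wpDl ?sqr_ge0//.
Qed.

Lemma root_plus_gt0 w : 0 < root_plus w.
Proof.
have := sqrt_gt_norm w; have := ler_norm (- w); rewrite normrN /root_plus.
by lra.
Qed.

Lemma root_minus_lt0 w : root_minus w < 0.
Proof.
have := sqrt_gt_norm w; have := ler_norm w; rewrite /root_minus; by lra.
Qed.

Lemma root_gap_gt0 w : 0 < root_gap w.
Proof. by rewrite subr_gt0 (lt_trans (root_minus_lt0 w)) ?root_plus_gt0. Qed.

(** With [root_prod], Vieta's formulas for [z^2 - w z - 1]. *)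
Lemma root_sum w : root_plus w + root_minus w = w.
Proof. by rewrite /root_plus /root_minus; field. Qed.

Lemma root_prod w : root_plus w * root_minus w = -1.
Proof.
have : Num.sqrt (w ^+ 2 + 4) ^+ 2 = w ^+ 2 + 4.
  by rewrite sqr_sqrtr// addr_ge0 ?sqr_ge0.
rewrite /root_plus /root_minus; move: (Num.sqrt _) => q hq.
have -> : (w + q) / 2 * ((w - q) / 2) = (w ^+ 2 - q ^+ 2) / 4 by field.
by rewrite hq; field.
Qed.

Lemma nonneg_weights_pullback s : nonneg_weights s -> nonneg_weights (pullback s).
Proof.
elim: s => // p s IH /= /andP[p0 /IH ->]; rewrite andbT.
have g0 := ltW (root_gap_gt0 p.2).
have a0 := divr_ge0 (ltW (root_plus_gt0 p.2)) g0.
have m0 : 0 <= - root_minus p.2 by rewrite oppr_ge0 ltW ?root_minus_lt0.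
by rewrite (mulr_ge0 p0 a0) (mulr_ge0 p0 (divr_ge0 m0 g0)).
Qed.

Lemma total_weight_pullback s : total_weight (pullback s) = total_weight s.
Proof.
elim: s => // p s IH; rewrite /total_weight /pullback /= !big_cons /= addrA.
congr (_ + _); last exact: IH.
have g0 := lt0r_neq0 (root_gap_gt0 p.2).
by rewrite -mulrDr -mulrDl -/(root_gap p.2) divff ?mulr1.
Qed.

Lemma Im_joukowski z : upper z -> complex.Im z <= complex.Im (joukowski z).
Proof.
move=> uz.
have -> : complex.Im (joukowski z) = complex.Im z - complex.Im z^-1.
  by rewrite /joukowski; case: (z) (z^-1) => ? ? [].
rewrite Im_inv mulNr opprK lerDl divr_ge0 ?sqn_ge0//; exact: ltW.
Qed.

Lemma upper_joukowski z : upper z -> upper (joukowski z).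
Proof. by move=> uz; exact: lt_le_trans uz (Im_joukowski uz). Qed.

Lemma upper_iter_joukowski k z : upper z -> upper (iter k joukowski z).
Proof. by move=> uz; elim: k => //= k; exact: upper_joukowski. Qed.

Lemma upper_neq0 z : upper z -> z != 0.
Proof. by apply: contraTneq => ->; rewrite /upper ltxx. Qed.

(** Atom by atom, [z - 1/z - w] factors as [(z - r1) (z - r2) / z] by Vieta, and its inverse splits
    into partial fractions. *)
Lemma cauchy_sum_pullback s z : upper z ->
  cauchy_sum (pullback s) z = cauchy_sum s (joukowski z).
Proof.
move=> uz; elim: s => [|p s IH]; first by rewrite /cauchy_sum !big_nil.
rewrite /cauchy_sum /pullback /= !big_cons /= addrA; congr (_ + _); last exact: IH.
have z0 := upper_neq0 uz.
have n1 := upper_kernel_neq0 (root_plus p.2) uz.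
have n2 := upper_kernel_neq0 (root_minus p.2) uz.
have g0 : (root_plus p.2)%:C - (root_minus p.2)%:C != 0.
  by rewrite -rmorphB -/(root_gap p.2) fmorph_eq0 gt_eqF// root_gap_gt0.
have eE : joukowski z - p.2%:C =
    (z - (root_plus p.2)%:C) * (z - (root_minus p.2)%:C) / z.
  have hs : p.2%:C = (root_plus p.2)%:C + (root_minus p.2)%:C :> R[i].
    by rewrite -rmorphD root_sum.
  have hp : (root_plus p.2)%:C * (root_minus p.2)%:C = -1 :> R[i].
    by rewrite -rmorphM root_prod rmorphN rmorph1.
  apply: (mulIf z0); rewrite divfK// mulrBl mulrBl mulVf// hs.
  rewrite -[1]opprK -hp; ring.
rewrite eE /root_gap; move: (root_plus p.2) (root_minus p.2) n1 n2 g0 {eE}.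
move=> a b n1 n2 g0; rewrite !(rmorphM, fmorphV, rmorphB, rmorphN) /=.
by field; rewrite z0 n1 n2 g0.
Qed.

(** Starts from the unit mass at 0, whose Cauchy transform is [1/z]; each pullback composes with
    [joukowski]. *)
Definition power_atoms k : seq (R * R) := iter k pullback [:: (1, 0)].

Lemma nonneg_weights_power k : nonneg_weights (power_atoms k).
Proof.
by elim: k => [|k IH] /=; [rewrite ler01|exact: nonneg_weights_pullback].
Qed.

Lemma total_weight_power k : total_weight (power_atoms k) = 1.
Proof.
elim: k => [|k IH]; first by rewrite /total_weight big_seq1.
by rewrite /= total_weight_pullback.
Qed.

Lemma cauchy_sum_power k z : upper z ->
  cauchy_sum (power_atoms k) z = (iter k joukowski z)^-1.
Proof.
elim: k z => [|k IH] z uz.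
  by rewrite /cauchy_sum big_seq1 /= subr0 mul1r.
rewrite iterSr -IH; last exact: upper_joukowski.
by rewrite -cauchy_sum_pullback.
Qed.

Lemma exists_power k : exists mu : probability R R,
  (forall z, upper z -> Htr mu z = iter k joukowski z) /\ finite_variance mu.
Proof.
have [mu amu] := exists_probability_atomic (nonneg_weights_power k) (total_weight_power k).
exists mu; split=> [z uz|].
  by rewrite /Htr /Gtr (Cintegral_atomic amu uz) cauchy_sum_power// invrK.
by have [] := amu (fun x => x ^+ 2) (@exprn_measurable R setT 2).
Qed.

(** Each power is constructed explicitly from its atoms; the convolution relation is then checked on
    transforms. *)
Lemma exists_mpow (nu : probability R R) k :
  (forall z, upper z -> Htr nu z = joukowski z) -> finite_variance nu ->
  exists mu : probability R R, [/\ mpow nu k.+1 mu,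
    (forall z, upper z -> Htr mu z = iter k.+1 joukowski z) &
    finite_variance mu].
Proof.
move=> hnu fnu; elim: k => [|k [mu [pmu hmu _]]]; first by exists nu.
have [lam [hlam flam]] := exists_power k.+2.
exists lam; split => //; exists mu; split=> // z uz.
by rewrite hlam// hmu// hnu//; exact: upper_iter_joukowski.
Qed.

(** Atoms of the representing measure [rho] of the n-th power: each step of the iteration subtracts
    the inverse of the current iterate, which is the Cauchy transform of the k-th power. The total
    mass is therefore [n]. *)
Definition variance_atoms n : seq (R * R) := \big[cat/[::]]_(k < n) power_atoms k.

Lemma nonneg_weights_variance n : nonneg_weights (variance_atoms n).
Proof.
elim: n => [|n IH]; first by rewrite /variance_atoms big_ord0.
by rewrite /variance_atoms big_ord_recr /nonneg_weights all_cat; apply/andP; split;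
  [exact: IH|exact: nonneg_weights_power].
Qed.

Lemma total_weight_variance n : total_weight (variance_atoms n) = n%:R.
Proof.
elim: n => [|n IH]; first by rewrite /total_weight /variance_atoms big_ord0 big_nil.
rewrite /variance_atoms big_ord_recr /total_weight big_cat /=.
by rewrite -[X in X + _]/(total_weight (variance_atoms n)) IH
  -[X in _ + X]/(total_weight (power_atoms n)) total_weight_power natr1.
Qed.

Lemma iter_joukowskiE n z : upper z ->
  iter n joukowski z = z - cauchy_sum (variance_atoms n) z.
Proof.
move=> uz; elim: n => [|n IH].
  by rewrite /cauchy_sum /variance_atoms big_ord0 big_nil subr0.
rewrite /variance_atoms big_ord_recr /cauchy_sum big_cat /=.
rewrite -[X in _ - (X + _)]/(cauchy_sum (variance_atoms n) z)
  -[X in _ - (_ + X)]/(cauchy_sum (power_atoms n) z) cauchy_sum_power//.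
by rewrite opprD addrA -IH.
Qed.

End bernoulli_powers.

Theorem theorem2p4 (R : realType) :
  (* (1) injectivity for n-divisible measures *)
  (forall (n : nat) (mu : probability R R) (a : R)
          (rho : {finite_measure set R -> \bar R}),
     (1 <= n)%N -> finite_variance mu -> Hrepr mu a rho -> mdivisible n mu ->
     (forall z1 z2 : R[i], upper z1 -> upper z2 -> z1 != z2 ->
        complex.Im z1 * complex.Im z2 > mass rho / n%:R ->
        Htr mu z1 != Htr mu z2)
     /\
     (forall z1 z2 : R[i],
        complex.Im z1 > Num.sqrt (mass rho / n%:R) ->
        complex.Im z2 > Num.sqrt (mass rho / n%:R) ->
        Htr mu z1 = Htr mu z2 -> z1 = z2))
  /\
  (* (1) optimality of the constant rho(R)/n *)
  (forall n : nat, (1 <= n)%N ->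
     exists (mu : probability R R) (a : R)
            (rho : {finite_measure set R -> \bar R}) (z1 z2 : R[i]),
       finite_variance mu /\ Hrepr mu a rho /\ mdivisible n mu /\
       upper z1 /\ upper z2 /\ z1 != z2 /\
       complex.Im z1 * complex.Im z2 = mass rho / n%:R /\
       Htr mu z1 = Htr mu z2)
  /\
  (* (2) infinitely divisible: H_mu and G_mu injective on C^+ *)
  (forall (mu : probability R R) (a : R)
          (rho : {finite_measure set R -> \bar R}),
     finite_variance mu -> Hrepr mu a rho -> minf_divisible mu ->
     (forall z1 z2 : R[i], upper z1 -> upper z2 ->
        Htr mu z1 = Htr mu z2 -> z1 = z2)
     /\
     (forall z1 z2 : R[i], upper z1 -> upper z2 ->
        Gtr mu z1 = Gtr mu z2 -> z1 = z2)).
Proof.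
split; last split.
- move=> n mu a rho n1 _ hr dv; split=> [z1 z2 u1 u2 z12 hlt|z1 z2 h1 h2 H12].
    exact: ndivisible_Htr_neq n1 hr dv u1 u2 z12 hlt.
  have r0 : 0 <= mass rho / n%:R by rewrite divr_ge0 ?mass_ge0 ?ler0n.
  have s0 := sqrtr_ge0 (mass rho / n%:R).
  apply/eqP; apply: contraPT (H12) => z12; apply/eqP.
  apply: (ndivisible_Htr_neq n1 hr dv _ _ z12).
  + exact: le_lt_trans s0 h1.
  + exact: le_lt_trans s0 h2.
  (* Both heights exceed the square root, so their product exceeds its square. *)
  + by rewrite -{1}(sqr_sqrtr r0) expr2 ltr_pM.
- case=> // n _.
  (* The Bernoulli law itself; the divisible measure is its power of exponent [n.+1]. *)
  have [nu [hnu fnu]] := exists_power R 1.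
  have [mu [pmu hmu fmu]] := exists_mpow n hnu fnu.
  have [rho [arho mrho]] := exists_finite_atomic (nonneg_weights_variance R n.+1).
  (* [joukowski] is invariant under [z -> -1/z], which exchanges [2i] and [i/2]; the product of
     heights is 1, the mass [n.+1] divided by [n.+1]. *)
  have u1 : upper (0 +i* 2 : R[i]) by rewrite /upper /= ltr0n.
  have u2 : upper (0 +i* 2^-1 : R[i]) by rewrite /upper /= invr_gt0 ltr0n.
  exists mu, 0, rho, (0 +i* 2), (0 +i* 2^-1); split => //; split.
    move=> z uz; rewrite hmu// iter_joukowskiE// (Cintegral_atomic_opp arho uz).
    by rewrite rmorph0 add0r.
  split; first by exists nu.
  split => //; split => //; split; first by rewrite eq_complex /= eqxx /=; lra.
  split; first by rewrite mrho total_weight_variance /= !divff ?pnatr_eq0.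
  have jE : joukowski (0 +i* 2 : R[i]) = joukowski (0 +i* 2^-1).
    by apply/eqP; rewrite eq_complex /=; apply/andP; split; apply/eqP; field.
  by rewrite !hmu// !iterSr jE.
- move=> mu a rho _ hr dv.
  have inj z1 z2 : upper z1 -> upper z2 -> Htr mu z1 = Htr mu z2 -> z1 = z2.
    move=> u1 u2 H12; apply/eqP; apply: contraPT (H12) => z12; apply/eqP.
    have y12 : 0 < complex.Im z1 * complex.Im z2 by rewrite mulr_gt0.
    (* The order of divisibility is chosen for the given pair, large enough that [mass rho / n]
       falls below the product of heights. *)
    have [n hn] : exists n : nat, mass rho / (complex.Im z1 * complex.Im z2) < n%:R.
      by exists (Num.truncn (mass rho / (complex.Im z1 * complex.Im z2))).+1; rewrite truncnS_gt.
    have n0 : (0 < n)%N.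
      rewrite -(ltr0n R); apply: le_lt_trans hn.
      by rewrite divr_ge0 ?mass_ge0 ?(ltW y12).
    apply: (ndivisible_Htr_neq n0 hr (dv n n0) u1 u2 z12).
    by rewrite ltr_pdivrMr ?ltr0n// mulrC -ltr_pdivrMr.
  split=> // z1 z2 u1 u2 G12; apply: inj => //; by rewrite /Htr G12.
Qed.
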